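(* Let $\omega$ be a primitive third root of unity. Then for all nonnegative integers $a$ and $m$, $$\begin{aligned}\det_{0\le i,j\le a-1}\left(\omega\,\delta_{ij}+\binom{m+i+j}{j}\right)={}&\frac{(1+\omega)^a\,2^{\lfloor a/2\rfloor}}{\prod_{i=1}^{\lfloor a/2\rfloor}(2i-1)!!\,\prod_{i=1}^{\lfloor(a-1)/2\rfloor}(2i-1)!!}\\&\times\prod_{i\ge0}\left(\tfrac m2+3i+1\right)_{\lfloor(a-4i)/2\rfloor}\left(\tfrac m2+3i+3\right)_{\lfloor(a-4i-3)/2\rfloor}\\&\qquad\cdot\left(\tfrac m2+a-i+\tfrac12\right)_{\lfloor(a-4i-1)/2\rfloor}\left(\tfrac m2+a-i-\tfrac12\right)_{\lfloor(a-4i-2)/2\rfloor}.\end{aligned}$$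
   Context: $\delta_{ij}$ is the Kronecker delta; $(\alpha)_k=\alpha(\alpha+1)\cdots(\alpha+k-1)$ for $k\ge1$, $(\alpha)_0=1$; $(2i-1)!!=1\cdot3\cdots(2i-1)$; empty products and the empty determinant are 1. In the subscripts on the right-hand side, $\lfloor\alpha\rfloor$ is the usual floor if $\alpha\ge0$ but is read as $0$ if $\alpha<0$, so that the product over $i\ge0$ is finite. *)

(* Defs.v *)
From mathcomp Require Import all_boot all_order all_algebra.

Set Implicit Arguments.
Unset Strict Implicit.
Unset Printing Implicit Defensive.

Import GRing.Theory.
Local Open Scope ring_scope.

(* The rising factorial (alpha)_k. *)
Definition pochhammer (R : nzRingType) (alpha : R) (k : nat) : R :=
  \prod_(j < k) (alpha + j%:R).

(* (2i-1)!! = 1 * 3 * ... * (2i-1), as a function of i. *)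
Definition odd_double_fact (i : nat) : nat :=
  (\prod_(1 <= k < i.+1) (2 * k - 1))%N.

(* The subscripts use truncated subtraction on nat followed by halving: this is
   the floor of the half when the difference is nonnegative, and 0 when it is
   negative, which is exactly the convention that keeps the product over all
   i >= 0 finite.  The differences a - i in the bases are taken in C, hence not
   truncated. *)
Definition hole_factor (C : fieldType) (a m i : nat) : C :=
  pochhammer (m%:R / 2%:R + 3%:R * i%:R + 1) (a - 4 * i)./2
  * pochhammer (m%:R / 2%:R + 3%:R * i%:R + 3%:R) (a - 4 * i - 3)./2
  * pochhammer (m%:R / 2%:R + a%:R - i%:R + 1 / 2%:R) (a - 4 * i - 1)./2
  * pochhammer (m%:R / 2%:R + a%:R - i%:R - 1 / 2%:R) (a - 4 * i - 2)./2.

(* All factors with i >= a are 1, so the product over all i >= 0 is the product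
   over i < a, as is any product over i < N with N >= a. *)
Lemma hole_factor_eq1 (C : fieldType) (a m i : nat) :
  (a <= i)%N -> hole_factor C a m i = 1.
Proof.
move=> le_ai; have /eqP e0 : (a - 4 * i == 0)%N.
  by rewrite subn_eq0 (leq_trans le_ai) // leq_pmull.
by rewrite /hole_factor /pochhammer e0 !sub0n !big_ord0 !mul1r.
Qed.

Lemma prod_hole_factor_stable (C : fieldType) (a m N : nat) : (a <= N)%N ->
  \prod_(i < N) hole_factor C a m i = \prod_(i < a) hole_factor C a m i.
Proof.
move=> le_aN; rewrite -!(big_mkord xpredT (hole_factor C a m)).
rewrite (big_cat_nat _ le_aN) //= [X in _ * X]big_nat_cond.
rewrite [X in _ * X]big1 ?mulr1 // => i /andP[/andP[le_ai _] _].
exact: hole_factor_eq1.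
Qed.

(* Main.v *)
Require Import Defs.
From mathcomp Require Import all_boot all_order all_algebra.
From mathcomp Require Import perm zify ring.

(** Both sides are polynomials in [m], and the determinant is identified by its
    degree, its zeros and one value.

    The row of index [i] of the binomial matrix consists of the first [a]
    coefficients of [(1 - x)^(-m-1) (1 / (1 - x))^i], so the matrix is the
    truncation at [x^a] of the operator
    [T : f(x) |-> (1 - x)^(-m-1) f(1 / (1 - x))] on polynomials of degree less
    than [a].  The map [x |-> 1 / (1 - x)] has order three, which is why third
    roots of unity are special.

    Zeros.  For [m = -n] with [n] a positive integer, [T] is an honest operator on
    the polynomials of degree less than [n], with [T^3 = (-1)^(n-1)], and it is
    diagonalized by the products of powers of [x + omega] and [x + omega^2]
    ([moebius_eigenpoly]).  When [n] is even, [- omega] is an eigenvalue, and the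
    eigenvectors of degree less than [a] lie in the kernel of the matrix
    ([corank_even]).  When [n] is odd, [omega + T] coincides with
    [- omega^2 T^2] on the sum of the eigenspaces for the eigenvalues other than
    [omega], and [T^2] sends polynomials of low degree to multiples of [x^a]
    ([corank_odd]).  In both cases a dimension count bounds the corank from
    below, hence the multiplicity of the zero [m = -n] ([corank_dvdp]).

    Degree.  In the basis [x^(i - i./2) (1 - x)^(i./2)] the entries of the matrix
    have small degrees, and the determinant has degree at most [a^2 %/ 4]
    ([size_det_hole_mx]).  The product of rising factorials has degree exactly
    [a^2 %/ 4], and the multiplicities of its zeros are at most the coranks above
    ([count_roots_even], [count_roots_odd], [size_product_roots]).  Therefore it
    divides the determinant with a constant quotient ([det_hole_mx_proportional]).

    Constant.  At [m = -1] the determinant of size [a + 1] reduces to [1 + omega]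
    times the determinant of size [a] at [m = 1] ([det_hole_mx_opp1]).  The products on
    the right-hand side satisfy the same recursion: their quotient telescopes to
    an identity between odd double factorials ([prod_hole_step]). *)

Set Implicit Arguments.
Unset Strict Implicit.
Unset Printing Implicit Defensive.
Import Order.TTheory GRing.Theory Num.Theory.
Local Open Scope ring_scope.

(** * Determinants of polynomial matrices *)

(** After an invertible change of rows over the field, [\rank K] rows of [M]
    vanish at [c], and each of them gives the determinant a factor [X - c]. *)
Lemma corank_dvdp (F : fieldType) (a q : nat) (M : 'M[{poly F}]_a) (c : F)
    (K : 'M[F]_(q, a)) :
  K *m map_mx (horner_eval c) M = 0 -> ('X - c%:P) ^+ \rank K %| \det M.
Proof.
move=> KM0; pose r := \rank K; pose N := map_mx polyC (row_ebase K) *m M.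
have detN : \det N = (\det (row_ebase K)) *: \det M.
  by rewrite det_mulmx det_map_mx mul_polyC.
have -> : ('X - c%:P) ^+ \rank K %| \det M = (('X - c%:P) ^+ r %| \det N).
  rewrite detN dvdpZr // -unitfE -unitmxE; exact: row_ebase_unit.
have rowN (i j : 'I_a) : (i < r)%N -> 'X - c%:P %| N i j.
  move=> ltir; rewrite dvdp_XsubCl; apply/rootP.
  have -> : (N i j).[c] = (row_ebase K *m map_mx (horner_eval c) M) i j.
    rewrite !mxE horner_sum; apply: eq_bigr => l _.
    by rewrite !mxE hornerM hornerC.
  (* The rows of [pid_mx r *m row_ebase K] span the row space of [K]. *)
  have K0 : (pid_mx r : 'M_(q, a)) *m row_ebase K *m map_mx (horner_eval c) M = 0.
    apply: (can_inj (mulKmx (col_ebase_unit K))).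
    by rewrite mulmx0 !mulmxA mulmx_ebase.
  have := congr1 (mulmx (pid_mx r : 'M_(a, q))) K0.
  rewrite mulmx0 !mulmxA pid_mx_id ?rank_leq_row // -mulmxA.
  move=> /matrixP/(_ i j); rewrite mxE (bigD1 i) //= big1 ?addr0.
    by rewrite mxE eqxx ltir mul1r [RHS]mxE.
  by move=> l; rewrite mxE eq_sym => /negPf nli; rewrite (inj_eq val_inj) nli mul0r.
rewrite /determinant; apply: (big_ind (fun p => _ %| p)) => [|p1 p2|s _].
- exact: dvdp0.
- exact: dvdp_add.
apply: dvdp_mull.
have -> : ('X - c%:P) ^+ r = \prod_(i < a) (if (i < r)%N then 'X - c%:P else 1).
  rewrite -big_mkcond -(big_ord_widen _ (fun=> 'X - c%:P)) ?rank_leq_col //.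
  by rewrite prodr_const card_ord.
apply: (big_ind2 (fun p q => p %| q)) => [|p1 p2 q1 q2|i _].
- exact: dvdpp.
- exact: dvdp_mul.
by case: ifP => [/rowN//|_]; exact: dvd1p.
Qed.

(** Degrees weighted by rows and columns: when the degree of entry [(i, j)] is
    at most [c j - r i], every term of the Leibniz expansion has degree at most
    the difference of the total weights. *)
Lemma size_det_leq (R : idomainType) (n : nat) (Q : 'M[{poly R}]_n)
    (r c : 'I_n -> nat) :
  (forall i j, Q i j != 0 -> (size (Q i j) + r i <= (c j).+1)%N) ->
  (size (\det Q) <= (\sum_j c j - \sum_i r i).+1)%N.
Proof.
move=> sizeQ; rewrite /determinant.
apply: (big_ind (fun p : {poly R} => size p <= _)%N) => [|p1 p2 le1 le2|s _].
- by rewrite size_poly0.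
- by rewrite (leq_trans (size_polyD _ _)) // geq_max le1.
rewrite mulr_sign [size _](_ : _ = size (\prod_i Q i (s i))); last first.
  by case: ifP => // _; rewrite size_polyN.
have [/existsP[i /eqP Qi0]|/existsPn Qn0] := boolP [exists i, Q i (s i) == 0].
  by rewrite (bigD1 i) //= Qi0 mul0r size_poly0.
rewrite size_prod // card_ord leq_subLR -ltnS.
have : (\sum_i (size (Q i (s i)) + r i) <= \sum_i (c (s i)).+1)%N.
  by apply: leq_sum => i _; apply: sizeQ.
have -> : (\sum_j c j = \sum_i c (s i))%N by rewrite (reindex_inj (@perm_inj _ s)).
under [X in (_ <= X)%N -> _]eq_bigr do rewrite -addn1.
rewrite !big_split /= sum1_card card_ord; lia.
Qed.

Lemma dvdp_prod_count (F : fieldType) (s : seq F) (D : {poly F}) : D != 0 ->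
  (forall x, count_mem x s <= mup x D)%N -> \prod_(x <- s) ('X - x%:P) %| D.
Proof.
elim: s D => [|x s IHs] D D0 leD; first by rewrite big_nil dvd1p.
have: 'X - x%:P %| D.
  by rewrite XsubC_dvd // (leq_trans _ (leD x)) //= eqxx.
case/dvdpP=> q Dq.
have q0 : q != 0 by apply: contraNneq D0 => q0; rewrite Dq q0 mul0r.
rewrite big_cons Dq mulrC dvdp_mul2r ?polyXsubC_eq0 //.
apply: IHs => // y; move: (leD y); rewrite Dq mupM ?polyXsubC_eq0 //=.
by rewrite (mup_XsubCX 1) eq_sym; case: eqVneq; lia.
Qed.

Section KernelCap.
Variables (F : fieldType) (k n c : nat) (A : 'M[F]_(k, n)).

Lemma cap_coord_rank : (c <= n)%N -> row_free A ->
  (k + c - n <= \rank (A :&: (pid_mx c : 'M_n))%MS)%N.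
Proof.
move=> lecn /eqP rA; have := mxrank_sum_cap A (pid_mx c : 'M_n).
rewrite rA rank_pid_mx //; have := rank_leq_col (A + (pid_mx c : 'M_n))%MS; lia.
Qed.

Lemma sub_pid_mx0 (v : 'rV[F]_n) (j : 'I_n) :
  (v <= (pid_mx c : 'M_n))%MS -> (c <= j)%N -> v 0 j = 0.
Proof.
case/submxP=> w -> lecj; rewrite mxE big1 // => l _.
by rewrite mxE; case: eqP => [->|_] /=; rewrite ?mulr0 // ltnNge lecj mulr0.
Qed.
End KernelCap.

(** * Binomial polynomials and an action of order three *)

(** The binomial coefficient [binomial(X + l + j, j)] as a polynomial in [X].
    At [X = m] it is an entry of the matrix; at [X = -n] it is, up to sign, a
    coefficient of a power of [1 - x]. *)
Definition binom_poly (F : numFieldType) (l j : nat) : {poly F} :=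
  (j`!%:R)^-1 *: \prod_(k < j) ('X + (l + k.+1)%:R%:P).

Section BinomialPolynomials.
Variable F : numFieldType.
Implicit Types l j m n : nat.
Local Notation B := (binom_poly F).

Lemma natr_fact_neq0 j : j`!%:R != 0 :> F.
Proof. by rewrite pnatr_eq0 -lt0n fact_gt0. Qed.

Lemma binom_poly0 l : B l 0 = 1.
Proof. by rewrite /binom_poly big_ord0 invr1 scale1r. Qed.

Lemma size_binom_poly l j : (size (B l j) <= j.+1)%N.
Proof.
apply: leq_trans (size_scale_leq _ _) _.
have := size_poly_prod_leq predT (fun k : 'I_j => 'X + (l + k.+1)%:R%:P : {poly F}).
move/leq_trans; apply; rewrite card_ord.
under eq_bigr do rewrite size_XaddC.
by rewrite sum_nat_const card_ord; lia.
Qed.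

Lemma prod_rising_nat m j : (\prod_(k < j) (m + k.+1) = 'C(m + j, j) * j`!)%N.
Proof.
rewrite bin_ffact; elim: j => [|j IHj]; first by rewrite big_ord0 ffactn0.
by rewrite big_ord_recr /= IHj addnS ffactnS /= mulnC.
Qed.

Lemma binom_poly_nat l j m : (B l j).[m%:R] = 'C(m + l + j, j)%:R.
Proof.
rewrite hornerZ horner_prod (eq_bigr (fun k : 'I_j => (m + l + k.+1)%:R)).
  by rewrite -natr_prod prod_rising_nat natrM mulrCA mulVf ?mulr1 // natr_fact_neq0.
by move=> k _; rewrite hornerD hornerX hornerC -natrD addnA.
Qed.

Lemma binom_poly_opp_ge l j n : (B (n + l) j).[- n%:R] = 'C(l + j, j)%:R.
Proof.
rewrite hornerZ horner_prod (eq_bigr (fun k : 'I_j => (l + k.+1)%:R)).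
  by rewrite -natr_prod prod_rising_nat natrM mulrCA mulVf ?mulr1 // natr_fact_neq0.
by move=> k _; rewrite hornerD hornerX hornerC -addnA [in LHS]natrD addKr.
Qed.

(** At [X = -n], row [l < n] of the binomial matrix lists the coefficients of
    [(1 - x)^(n-1-l)]: this turns the matrix into the operator [moebius n]
    below. *)
Lemma binom_poly_opp_lt l j n : (l < n)%N ->
  (B l j).[- n%:R] = (- 1) ^+ j * 'C(n.-1 - l, j)%:R.
Proof.
move=> ltln; rewrite hornerZ horner_prod.
have -> : \prod_(k < j) ('X + (l + k.+1)%:R%:P).[- n%:R]
        = (-1) ^+ j * ((n.-1 - l) ^_ j)%:R :> F.
  elim: j => [|j IHj]; first by rewrite big_ord0 mul1r.
  rewrite big_ord_recr /= IHj hornerD hornerX hornerC exprSr ffactnSr.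
  have [ltj|lej] := ltnP (n.-1 - l) j.
    by rewrite ffact_small // mul0n !mulr0 mul0r.
  rewrite [in - n%:R](_ : n = (n.-1 - l - j) + (l + j.+1))%N; last by lia.
  by rewrite [in LHS]natrD natrM; ring.
by rewrite -bin_ffact natrM; field; rewrite natr_fact_neq0.
Qed.

Lemma binom_poly_pascal l j :
  B l j.+1 - B l.+1 j.+1 = - B l.+1 j.
Proof.
rewrite /binom_poly big_ord_recl big_ord_recr /=.
under eq_bigr do rewrite /bump /= add1n -addSnnS.
set P := \prod_(k < j) _; rewrite factS natrM addnS addn0 !addnS addSn.
rewrite invfM -!scalerBr.
have -> : ('X + (l.+1)%:R%:P) * P - P * ('X + (l + j).+2%:R%:P) = - j.+1%:R *: P.
  rewrite -mul_polyC -addnS -addSn natrD polyCN polyCD; ring.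
rewrite !scalerA -scaleNr; congr (_ *: _).
by field; rewrite natr_fact_neq0 nat1r pnatr_eq0.
Qed.
End BinomialPolynomials.

Section Moebius.
Variable F : fieldType.
Implicit Types (n : nat) (f : {poly F}).

(** On polynomials of degree less than [n] this is
    [f(x) |-> (1 - x)^(n-1) f(1 / (1 - x))], the weighted action of a fractional
    linear map of order three; its cube is the sign [(-1)^(n-1)]. *)
Definition moebius n f : {poly F} :=
  \sum_(i < n) f`_i *: (1 - 'X) ^+ (n.-1 - i).

Lemma moebius_lin n (I : finType) (c : I -> F) (f : I -> {poly F}) :
  moebius n (\sum_i c i *: f i) = \sum_i c i *: moebius n (f i).
Proof.
rewrite /moebius; under [RHS]eq_bigr do rewrite scaler_sumr.
rewrite exchange_big; apply: eq_bigr => i _ /=.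
rewrite coef_sum scaler_suml; apply: eq_bigr => k _.
by rewrite coefZ scalerA.
Qed.

Lemma moebiusS n f : (size f <= n)%N -> moebius n.+1 f = (1 - 'X) * moebius n f.
Proof.
move=> sf; rewrite /moebius big_ord_recr /= nth_default // scale0r addr0 mulr_sumr.
apply: eq_bigr => i _; rewrite -scalerAr -exprS; congr (_ *: _ ^+ _).
by have := ltn_ord i; lia.
Qed.

Lemma moebiusD n f g : moebius n (f + g) = moebius n f + moebius n g.
Proof.
by rewrite /moebius -big_split; apply: eq_bigr => i _ /=; rewrite coefD scalerDl.
Qed.

Lemma moebiusZ n c f : moebius n (c *: f) = c *: moebius n f.
Proof.
by rewrite /moebius scaler_sumr; apply: eq_bigr => i _ /=; rewrite coefZ scalerA.
Qed.

Lemma moebius_mulX n f : moebius n.+1 ('X * f) = moebius n f.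
Proof.
rewrite /moebius big_ord_recl coefXM scale0r add0r.
by apply: eq_bigr => i _; rewrite lift0 coefXM /=; congr (_ *: _ ^+ _); lia.
Qed.

(** The action is multiplicative on homogenized polynomials; one linear factor
    at a time is enough to compute it on every product of linear forms. *)
Lemma moebius_XaddC n c f : (size f <= n)%N ->
  moebius n.+1 (('X + c%:P) * f) = (1 + c%:P * (1 - 'X)) * moebius n f.
Proof.
move=> sf; rewrite mulrDl moebiusD moebius_mulX mul_polyC moebiusZ moebiusS //.
rewrite -mul_polyC; ring.
Qed.

Lemma size_exp_XaddC (u : F) s : size (('X + u%:P) ^+ s) = s.+1.
Proof. by rewrite -[u]opprK polyCN size_exp_XsubC. Qed.

Lemma size_linear_powers (u v : F) s t :
  size (('X + u%:P) ^+ s * ('X + v%:P) ^+ t) = (s + t).+1.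
Proof.
rewrite size_monicM ?monic_neq0 ?monic_exp ?monicXaddC //.
rewrite !size_exp_XaddC; lia.
Qed.

Lemma moebius_linear_powers (u v : F) s t :
  moebius (s + t).+1 (('X + u%:P) ^+ s * ('X + v%:P) ^+ t) =
  (1 + u%:P * (1 - 'X)) ^+ s * (1 + v%:P * (1 - 'X)) ^+ t.
Proof.
elim: s => [|s IHs]; last first.
  by rewrite !exprS -!mulrA moebius_XaddC ?IHs // size_linear_powers.
rewrite !mul1r; elim: t => [|t IHt].
  by rewrite /moebius big_ord1 !expr0 coef1 scale1r.
rewrite !exprS moebius_XaddC ?IHt //.
by rewrite size_exp_XaddC.
Qed.

Lemma moebius_1subX n d : (d < n)%N ->
  moebius n ((1 - 'X) ^+ d) = (1 - 'X) ^+ (n.-1 - d) * (- 'X) ^+ d.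
Proof.
move=> ltdn; rewrite -(subnKC ltdn) addSn /= addKn; elim: (_ - _)%N => [|i IHi].
  rewrite addn0 mul1r -[1 - 'X]opprB exprNn -polyC1 -polyCN -rmorphXn mul_polyC moebiusZ.
  have := moebius_linear_powers (-1) 0 d 0; rewrite !addn0 !mulr1 => ->.
  rewrite -mul_polyC rmorphXn -exprMn; congr (_ ^+ _); rewrite !polyCN polyC1; ring.
rewrite addnS moebiusS ?IHi ?exprS ?mulrA //.
rewrite (leq_trans (size_poly_exp_leq _ _)) //.
by rewrite -opprB size_polyN size_XsubC mul1n; lia.
Qed.

(** The square of the action is [f(x) |-> (-x)^(n-1) f(1 - 1 / x)], so that a
    polynomial of low degree is sent to one divisible by a high power of
    [x]. *)
Lemma moebius_moebius n f : (size f <= n)%N ->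
  moebius n (moebius n f) = \sum_(i < n) f`_i *: ((1 - 'X) ^+ i * (- 'X) ^+ (n.-1 - i)).
Proof.
move=> sf; rewrite {2}/moebius moebius_lin; apply: eq_bigr => i _; rewrite moebius_1subX.
  by have := ltn_ord i => lin; congr (_ *: (_ ^+ _ * _)); lia.
by have := ltn_ord i; lia.
Qed.

End Moebius.

(** * Eigenvectors of the action *)

Lemma sum_coef_widen (R : nzRingType) (p : {poly R}) (N : nat) (g : nat -> R) :
  (size p <= N)%N -> \sum_(l < N) p`_l * g l = \sum_(l < size p) p`_l * g l.
Proof.
move=> spN; rewrite (@big_ord_widen _ _ _ (size p) N (fun l => p`_l * g l)) //.
rewrite [RHS]big_mkcond.
by apply: eq_bigr => l _; case: ltnP => // /(nth_default 0) ->; rewrite mul0r.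
Qed.

Lemma coef_1subX_exp (R : nzRingType) d j :
  ((1 - 'X : {poly R}) ^+ d)`_j = (-1) ^+ j * 'C(d, j)%:R.
Proof.
elim: d j => [|d IHd] j; first by rewrite coef1; case: j => [|j]; rewrite ?mulr1 ?mulr0.
rewrite exprS mulrBl mul1r coefB coefXM IHd; case: j => [|j] /=.
  by rewrite subr0 !bin0.
by rewrite IHd binS natrD mulrDr exprS mulN1r !mulNr addrC.
Qed.

(** Evaluating at the root of the first linear form isolates the coefficient of
    index 0; dividing by that form then lowers [n]. *)
Lemma linear_powers_free (F : fieldType) (u v : F) n (c : 'I_n -> F) : u != v ->
  \sum_(s < n) c s *: (('X + u%:P) ^+ s * ('X + v%:P) ^+ (n.-1 - s)) = 0 ->
  forall s, c s = 0.
Proof.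
move=> neq_uv; elim: n c => [c _ []//|n IHn c].
rewrite big_ord_recl subn0 expr0 mul1r => sum0.
pose q := \sum_(s < n) c (lift ord0 s) *:
            (('X + u%:P) ^+ s * ('X + v%:P) ^+ (n.-1 - s)).
have {}sum0 : c ord0 *: ('X + v%:P) ^+ n + ('X + u%:P) * q = 0.
  rewrite -[RHS]sum0 mulr_sumr; congr (_ + _); apply: eq_bigr => s _.
  rewrite -scalerAr mulrA -exprS lift0; congr (_ *: (_ * _ ^+ _)).
  by have := ltn_ord s; rewrite /=; lia.
have c0 : c ord0 = 0.
  have := congr1 (horner^~ (- u)) sum0.
  rewrite hornerD hornerM hornerZ horner_exp !hornerD hornerX !hornerC addNr.
  rewrite mul0r addr0 => /eqP; rewrite mulf_eq0 expf_eq0 addrC subr_eq0.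
  by rewrite [v == u]eq_sym (negPf neq_uv) andbF orbF => /eqP.
move: sum0; rewrite c0 scale0r add0r => /eqP; rewrite mulf_eq0.
rewrite -size_poly_eq0 size_XaddC /= => /eqP q0 s.
by case: (unliftP ord0 s) => [t ->|-> //]; apply: IHn q0 t.
Qed.

Lemma card_mod3 n r : (r < 3)%N ->
  #|[set s : 'I_n | (s %% 3 == r)%N]| = ((n + 2 - r) %/ 3)%N.
Proof.
move=> ltr; rewrite -sum1_card big_mkcond /=.
under eq_bigr do rewrite inE.
elim: n => [|n IHn]; first by rewrite big_ord0; lia.
by rewrite big_ord_recr /= IHn; case: eqP; lia.
Qed.

Section Kernel.
Variables (F : numFieldType) (omega : F).
Hypothesis omega_eq : omega ^+ 2 + omega + 1 = 0.

(** The matrix of the theorem with [m] replaced by an indeterminate. *)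
Definition hole_mx a : 'M[{poly F}]_a :=
  \matrix_(i, j) ((omega * (i == j)%:R)%:P + binom_poly F i j).

(** Row vectors of length [a] are polynomials of degree less than [a]; on those
    of degree less than [n], multiplication by the matrix at [X = -n] is
    [omega + moebius n] followed by truncation at [x^a]. *)
Lemma hole_mx_kernel a n (p : {poly F}) : (size p <= a)%N -> (size p <= n)%N ->
  (forall j, (j < a)%N -> omega * p`_j + (moebius n p)`_j = 0) ->
  poly_rV p *m map_mx (horner_eval (- n%:R)) (hole_mx a) = 0 :> 'rV_a.
Proof.
move=> spa spn ker; apply/rowP => j; rewrite mxE [RHS]mxE -[RHS](ker j) //.
under eq_bigr do rewrite !mxE /horner_eval hornerD hornerC mulrDr.
rewrite big_split /=; congr (_ + _).
  rewrite (bigD1 j) //= eqxx mulr1 mulrC big1 ?addr0 // => l /negPf ->.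
  by rewrite !mulr0.
rewrite (sum_coef_widen (fun l => (binom_poly F l j).[- n%:R]) spa) /moebius coef_sum.
under [RHS]eq_bigr do rewrite coefZ.
rewrite (sum_coef_widen (fun l => ((1 - 'X : {poly F}) ^+ (n.-1 - l))`_j) spn).
apply: eq_bigr => l _; rewrite binom_poly_opp_lt ?coef_1subX_exp //.
exact: leq_trans (ltn_ord l) spn.
Qed.

Lemma omega3 : omega ^+ 3 = 1.
Proof.
have -> : omega ^+ 3 = 1 + (omega - 1) * (omega ^+ 2 + omega + 1) by ring.
by rewrite omega_eq mulr0 addr0.
Qed.

Lemma omega_neq0 : omega != 0.
Proof. by apply/eqP => w0; move/eqP: omega_eq; rewrite w0 expr0n !add0r oner_eq0. Qed.

Lemma omega_neq1 : omega != 1.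
Proof.
apply/eqP => w1; move/eqP: omega_eq; rewrite w1 expr1n.
by rewrite (_ : 1 + 1 + 1 = 3%:R) ?pnatr_eq0 //; ring.
Qed.

Lemma omega_exp e : omega ^+ e = omega ^+ (e %% 3).
Proof. by rewrite {1}(divn_eq e 3) exprD mulnC exprM omega3 expr1n mul1r. Qed.

Lemma omega_neq2 : omega != omega ^+ 2.
Proof.
by rewrite expr2 -{1}[omega]mulr1 (inj_eq (mulfI omega_neq0)) eq_sym omega_neq1.
Qed.

Lemma omega_exp_eq e : (omega ^+ e == omega) = (e %% 3 == 1)%N.
Proof.
rewrite omega_exp; have: (e %% 3 < 3)%N by rewrite ltn_mod.
case: (_ %% 3)%N => [|[|[|//]]] _; rewrite ?eqxx //=.
  by rewrite eq_sym (negPf omega_neq1).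
by rewrite eq_sym (negPf omega_neq2).
Qed.

(** The linear forms [x + omega] and [x + omega^2] vanish at the two fixed
    points of [x |-> 1 / (1 - x)]; their products therefore diagonalize the
    action. *)
Definition eigenpoly n s : {poly F} :=
  ('X + omega%:P) ^+ s * ('X + (omega ^+ 2)%:P) ^+ (n.-1 - s).

Definition eigen_exponent n s := (s + 2 * (n.-1 - s))%N.

(** Both linear forms are eigenvectors in degree one:
    [1 + omega (1 - x) = - omega (x + omega)], and likewise for
    [omega^2]. *)
Lemma moebius_eigenpoly n s : (s < n)%N ->
  moebius n (eigenpoly n s) = ((-1) ^+ n.-1 * omega ^+ eigen_exponent n s) *: eigenpoly n s.
Proof.
move=> ltsn; rewrite /eigenpoly /eigen_exponent; set t := (n.-1 - s)%N.
have -> : n.-1 = (s + t)%N by rewrite /t; lia.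
have {1}-> : n = (s + t).+1 by rewrite /t; lia.
rewrite moebius_linear_powers.
have rot (u v : F) : u * v = - (1 + u) -> 1 + u%:P * (1 - 'X) = (- u)%:P * ('X + v%:P).
  move=> uv; rewrite polyCN [RHS]mulNr [in RHS]mulrDr -[in RHS]polyCM uv.
  by rewrite polyCN polyCD polyC1; ring.
rewrite (rot omega omega) ?(rot (omega ^+ 2) (omega ^+ 2)); first last.
- by rewrite -[RHS]addr0 -omega_eq; ring.
- have -> : omega ^+ 2 * omega ^+ 2 = omega ^+ 3 * omega by ring.
  by rewrite omega3 mul1r -[RHS]addr0 -omega_eq; ring.
rewrite !exprMn -!rmorphXn mulrACA -polyCM mul_polyC; congr (_ *: _).
by rewrite [(- omega) ^+ s]exprNn [(- _) ^+ t]exprNn mulrACA -exprD -exprM -exprD.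
Qed.

End Kernel.

(** * Coranks at negative integers *)

Section Corank.
Variables (F : numFieldType) (omega : F).
Hypothesis omega_eq : omega ^+ 2 + omega + 1 = 0.
Local Notation eigenpoly := (eigenpoly omega).
Local Notation hole_mx := (hole_mx omega).

Lemma size_eigenpoly n s : (s < n)%N -> size (eigenpoly n s) = n.
Proof. by move=> ltsn; rewrite size_linear_powers; lia. Qed.

Definition eigenrows n (S : {set 'I_n}) : 'M[F]_(#|S|, n) :=
  \matrix_(i < #|S|, j < n) (eigenpoly n (@enum_val _ (mem S) i))`_j.

Lemma mul_eigenrows n (S : {set 'I_n}) (w : 'rV_#|S|) :
  rVpoly (w *m eigenrows S) = \sum_i w 0 i *: eigenpoly n (enum_val i).
Proof.
rewrite -[RHS](@poly_rV_K _ n); last first.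
  rewrite (leq_trans (size_sum _ _ _)) //; apply/bigmax_leqP => i _.
  by rewrite (leq_trans (size_scale_leq _ _)) // size_eigenpoly.
congr rVpoly; apply/rowP => j; rewrite !mxE coef_sum.
by apply: eq_bigr => i _; rewrite mxE coefZ.
Qed.

Lemma row_free_eigenrows n (S : {set 'I_n}) : row_free (eigenrows S).
Proof.
apply/inj_row_free => w w0; have sum0 := mul_eigenrows w.
rewrite w0 linear0 in sum0.
pose c (s : 'I_n) := \sum_i (enum_val i == s)%:R * w 0 i.
have c0 : forall s, c s = 0.
  apply: (linear_powers_free (omega_neq2 omega_eq)); rewrite [RHS]sum0.
  under eq_bigr do rewrite scaler_suml.
  rewrite exchange_big; apply: eq_bigr => i _ /=.
  rewrite (bigD1 (enum_val i)) //= eqxx mul1r big1 ?addr0 // => s nes.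
  by rewrite eq_sym (negPf nes) mul0r scale0r.
apply/rowP => i; rewrite [RHS]mxE -(c0 (enum_val i)) /c (bigD1 i) //= eqxx mul1r.
rewrite big1 ?addr0 // => l nli.
by rewrite (inj_eq enum_val_inj) (negPf nli) mul0r.
Qed.

(** A lower bound on the corank of the matrix at [X = -n], by a dimension count
    inside the [n]-dimensional space of polynomials of degree less than [n]: the
    span of the eigenvectors indexed by [S] meets the polynomials of degree less
    than [c] in dimension at least [#|S| + c - n]. *)
Lemma corank_of_eigenspaces n a c (S : {set 'I_n}) :
    (c <= a)%N -> (c <= n)%N ->
    (forall p : {poly F}, (size p <= c)%N ->
       (exists w : 'I_#|S| -> F, p = \sum_(i < #|S|) w i *: eigenpoly n (enum_val i)) ->
       forall j, (j < a)%N -> omega * p`_j + (moebius n p)`_j = 0) ->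
  ('X + n%:R%:P) ^+ (#|S| + c - n) %| \det (hole_mx a).
Proof.
move=> leca lecn ker; pose K := (eigenrows S :&: (pid_mx c : 'M_n))%MS.
pose K' : 'M_(n, a) := \matrix_i poly_rV (rVpoly (row i K)).
have size_row i : (size (rVpoly (row i K)) <= c)%N.
  apply/leq_sizeP => j lecj; rewrite coef_rVpoly; case: insubP => // l _ Dl.
  apply: (@sub_pid_mx0 _ _ c); last by rewrite Dl.
  by rewrite (submx_trans (row_sub _ _)) // capmxSr.
have -> : 'X + n%:R%:P = 'X - (- n%:R)%:P :> {poly F} by rewrite polyCN opprK.
have K'M : K' *m map_mx (horner_eval (- n%:R)) (hole_mx a) = 0.
  apply/row_matrixP => i; rewrite row_mul rowK row0.
  apply: hole_mx_kernel; rewrite ?(leq_trans (size_row i)) //.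
  apply: ker => //; have : (row i K <= eigenrows S)%MS.
    by rewrite (submx_trans (row_sub _ _)) // capmxSl.
  by case/submxP => w ->; exists (fun l => w 0 l); exact: mul_eigenrows.
apply: dvdp_trans (corank_dvdp K'M); apply: dvdp_exp2l.
apply: leq_trans (cap_coord_rank lecn (row_free_eigenrows S)) _.
suff -> : (eigenrows S :&: (pid_mx c : 'M_n))%MS = K' *m lin1_mx (poly_rV \o rVpoly).
  exact: mxrankM_maxl.
apply/row_matrixP => i; rewrite row_mul rowK mul_rV_lin1 /=.
by rewrite poly_rV_K ?rVpolyK // (leq_trans (size_row i)).
Qed.

(** The indices of the eigenvectors with eigenvalue [(-1)^(n-1) omega]. *)
Definition eigen_indices n : {set 'I_n} :=
  [set s : 'I_n | (eigen_exponent n s %% 3 == 1)%N].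

Lemma card_eigen_indices n : #|eigen_indices n| = ((n + 1) %/ 3)%N.
Proof.
transitivity #|[set s : 'I_n | (s %% 3 == (2 * n) %% 3)%N]|.
  apply: eq_card => s; rewrite !inE /eigen_exponent; have := ltn_ord s => lts.
  by apply/eqP/eqP; lia.
rewrite card_mod3 ?ltn_mod //; lia.
Qed.

(** For even [n], [- omega] is an eigenvalue of the action, and its eigenvectors
    of degree less than [a] are killed by the matrix. *)
Lemma corank_even n a : ~~ odd n -> (0 < n)%N ->
  ('X + n%:R%:P) ^+ ((n + 1) %/ 3 - (n - a)) %| \det (hole_mx a).
Proof.
move=> evn n_gt0.
have -> : ((n + 1) %/ 3 - (n - a) = #|eigen_indices n| + minn a n - n)%N.
  by rewrite card_eigen_indices; lia.
apply: corank_of_eigenspaces; rewrite ?geq_minl ?geq_minr // => p _ [w ->] j _.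
rewrite moebius_lin !coef_sum mulr_sumr -big_split big1 //= => i _.
rewrite moebius_eigenpoly ?ltn_ord //; have := enum_valP i.
rewrite inE -(omega_exp_eq omega_eq).
move/eqP->; rewrite !coefZ -signr_odd; have -> : odd n.-1 by lia.
by rewrite expr1; ring.
Qed.

(** For odd [n] the action [T] satisfies [T^3 = 1] and [omega + T] is invertible,
    so the kernel appears only after truncation. On the sum of the eigenspaces
    for the eigenvalues other than [omega],
    [T^2 + omega T + omega^2 = 0], hence [omega + T = - omega^2 T^2]; and
    [T^2 f] vanishes to order [a] at 0 as soon as [f] has degree less than
    [n - a]. *)
Lemma corank_odd n a : odd n ->
  ('X + n%:R%:P) ^+ (minn a (n - a) - (n + 1) %/ 3) %| \det (hole_mx a).
Proof.
move=> oddn; pose c := minn a (n - a); rewrite -/c; have Dc : c = minn a (n - a) by [].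
have -> : (c - (n + 1) %/ 3 = #|~: eigen_indices n| + c - n)%N.
  by have := cardsC (eigen_indices n); rewrite card_ord card_eigen_indices; lia.
apply: corank_of_eigenspaces; rewrite ?geq_minl //; first by lia.
move=> p sp [w Dp] j ltja.
have quad : moebius n (moebius n p) + omega *: moebius n p + omega ^+ 2 *: p = 0.
  have mobE (s : 'I_n) :
      moebius n (eigenpoly n s) = omega ^+ eigen_exponent n s *: eigenpoly n s.
    rewrite moebius_eigenpoly ?ltn_ord // -signr_odd; have -> : odd n.-1 = false by lia.
    by rewrite expr0 mul1r.
  have mob2 : moebius n p = \sum_i (w i * omega ^+ eigen_exponent n (enum_val i)) *:
                           eigenpoly n (enum_val i).
    by rewrite Dp moebius_lin; apply: eq_bigr => i _; rewrite mobE scalerA.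
  rewrite mob2 moebius_lin Dp !scaler_sumr -!big_split big1 //= => i _.
  rewrite mobE !scalerA -!scalerDl [X in X *: _](_ : _ = 0) ?scale0r //.
  have := enum_valP i; rewrite !inE.
  rewrite [omega ^+ eigen_exponent _ _](omega_exp omega_eq).
  set e := (eigen_exponent _ _ %% 3)%N; have : (e < 3)%N by rewrite ltn_mod.
  case: e => [|[|[|//]]] //= _ _.
    by rewrite -[RHS](mulr0 (w i)) -omega_eq; ring.
  by rewrite -[RHS](mulr0 (w i * omega ^+ 2)) -omega_eq; ring.
have mm0 : (moebius n (moebius n p))`_j = 0.
  rewrite moebius_moebius ?coef_sum; last by rewrite (leq_trans sp) //; lia.
  rewrite big1 // => i _; rewrite coefZ.
  have [leci|ltic] := leqP c i; first by rewrite nth_default ?mul0r // (leq_trans sp).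
  rewrite exprNn mulrA coefMXn ifT ?mulr0 //; lia.
have := congr1 (fun q : {poly F} => q`_j) quad; rewrite !coefD !coefZ mm0 add0r coef0 => E.
by apply: (mulfI (omega_neq0 omega_eq)); rewrite mulr0 -[RHS]E; ring.
Qed.

End Corank.

(** * Degree and special values of the determinant *)

Section Degree.
Variables (F : numFieldType) (omega : F).
Local Notation hole_mx := (hole_mx omega).

(** The linear map [x^l |-> binom_poly l j] takes [f] to the coefficient of [x^j]
    in [(1 - x)^(-X-1) f(1 / (1 - x))].  For [f = x^u (1 - x)^t] this series is
    divisible by [x^t], so the degree in [X] drops by [t]. *)
Lemma binom_poly_functional N u t j : (u + t < N)%N ->
  \sum_(l < N) (('X ^+ u * (1 - 'X) ^+ t : {poly F})`_l)%:P * binom_poly F l j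
  = if (t <= j)%N then (-1) ^+ t * binom_poly F (u + t) (j - t) else 0.
Proof.
elim: t u j => [|t IHt] u j ltN.
  rewrite addn0 in ltN; rewrite leq0n !mul1r mulr1 addn0 subn0.
  rewrite (bigD1 (Ordinal ltN)) //= coefXn eqxx mul1r big1 ?addr0 // => l neql.
  by rewrite coefXn (negPf (_ : l != u :> nat)) ?mul0r.
have -> : ('X ^+ u * (1 - 'X) ^+ t.+1 : {poly F})
    = 'X ^+ u * (1 - 'X) ^+ t - 'X ^+ u.+1 * (1 - 'X) ^+ t.
  by rewrite !exprS; ring.
under eq_bigr do rewrite coefB polyCB mulrBl.
rewrite sumrB !IHt; try lia.
have [letj|ltjt] := leqP t j; last by rewrite subrr ifF //; lia.
rewrite addSn -mulrBr; have [->|neqtj] := eqVneq t j.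
  by rewrite subnn ltnn !binom_poly0 subrr mulr0.
have ltj : (t < j)%N by lia.
rewrite ltj (_ : j - t = (j - t.+1).+1)%N; last by lia.
by rewrite binom_poly_pascal exprS addnS; ring.
Qed.

Lemma sum_id_sub_half a : (\sum_(j < a) j - \sum_(i < a) i./2 = a ^ 2 %/ 4)%N.
Proof.
have : (\sum_(j < a) j = \sum_(i < a) i./2 + a ^ 2 %/ 4)%N; last by lia.
elim: a => [|a IHa]; first by rewrite !big_ord0.
rewrite !big_ord_recr /= IHa -!addnA; congr (_ + _)%N.
have [Ea|Oa] : a = (2 * a./2)%N \/ a = (2 * a./2).+1%N by lia.
  by rewrite Ea; set b := a./2; nia.
by rewrite Oa; set b := a./2; nia.
Qed.

(** One polynomial in each degree, so that the passage from the monomials is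
    triangular with diagonal entries 1 or -1.  The exponents are
    balanced: a factor [1 - x] lowers the degree in [X] of row [i] of the
    binomial part, and the order at 0 makes the contribution of [omega] vanish in
    the columns [j < i./2], where the entry has to be zero. *)
Definition balanced_basis i : {poly F} := 'X ^+ (uphalf i) * (1 - 'X) ^+ i./2.

(** The naive bound on the degree is [a (a - 1) / 2].  Replacing the monomials by
    [balanced_basis] makes entry [(i, j)] of degree at most [j - i./2], which
    gives the true degree. *)
Lemma size_det_hole_mx a : (size (\det (hole_mx a)) <= (a ^ 2 %/ 4).+1)%N.
Proof.
pose P : 'M[F]_a := \matrix_(i, l) (balanced_basis i)`_l.
pose Q := map_mx polyC P *m hole_mx a.
have halves i : (uphalf i + i./2 = i)%N by lia.
have detP : \det P != 0.
  rewrite det_trig.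
    apply/prodf_neq0 => i _; rewrite mxE /balanced_basis coefXnM.
    rewrite ifF; last by have := ltn_ord i; lia.
    rewrite coef_1subX_exp (_ : i - _ = i./2)%N; last by have := halves i; lia.
    by rewrite binn mulr1 signr_eq0.
  apply/is_trig_mxP => i j ltij; rewrite mxE /balanced_basis coefXnM.
  case: ifP => // _; rewrite coef_1subX_exp bin_small ?mulr0 //.
  by have := halves i; lia.
have -> : size (\det (hole_mx a)) = size (\det Q).
  by rewrite det_mulmx det_map_mx mul_polyC size_scale.
rewrite -sum_id_sub_half; apply: size_det_leq => i j.
have -> : Q i j = (omega * (balanced_basis i)`_j)%:P
    + (if (i./2 <= j)%N then (-1) ^+ i./2 * binom_poly F i (j - i./2) else 0).
  rewrite -[in binom_poly F i](halves i) -(@binom_poly_functional a) ?halves //.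
  rewrite mxE; under eq_bigr do rewrite !mxE mulrDr.
  rewrite big_split /=; congr (_ + _).
  rewrite (bigD1 j) //= eqxx mulr1 -polyCM mulrC big1 ?addr0 // => l /negPf ->.
  by rewrite mulr0 polyC0 mulr0.
have [lej|ltj] := leqP i./2 j; last first.
  rewrite /balanced_basis coefXnM ifT; last by lia.
  by rewrite mulr0 addr0 eqxx.
move=> _; rewrite (_ : j.+1 = (j - i./2).+1 + i./2)%N; last by lia.
rewrite leq_add2r (leq_trans (size_polyD _ _)) // geq_max.
rewrite (leq_trans (size_polyC_leq1 _)) //= -signr_odd mulr_sign.
by case: ifP; rewrite ?size_polyN size_binom_poly.
Qed.

Lemma det_hole_mx_nat a (m : nat) :
  (\det (hole_mx a)).[m%:R] =
  \det (\matrix_(i < a, j < a) (omega * (i == j)%:R + 'C(m + i + j, j)%:R)).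
Proof.
rewrite -[LHS](det_map_mx (horner_eval m%:R)); congr (\det _).
by apply/matrixP=> i j; rewrite !mxE /= /horner_eval hornerD hornerC binom_poly_nat.
Qed.

(** At [X = -1] row 0 is [(1 + omega, 0, ..., 0)] and the complementary minor is
    the transpose of the matrix of size [a] at [X = 1]. *)
Lemma det_hole_mx_opp1 a :
  (\det (hole_mx a.+1)).[-1] = (1 + omega) * (\det (hole_mx a)).[1].
Proof.
rewrite -[LHS](det_map_mx (horner_eval (-1))) (expand_det_row _ ord0).
rewrite (bigD1 ord0) //= big1 ?addr0 => [|j nj0]; last first.
  rewrite !mxE /= /horner_eval eq_sym (negPf nj0) mulr0 add0r.
  rewrite (@binom_poly_opp_lt F 0 j 1) //= bin_small ?mulr0 ?mul0r //.
  by rewrite lt0n.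
rewrite !mxE /= /horner_eval binom_poly0 mulr1 hornerD !hornerC addrC.
congr (_ * _); rewrite /cofactor addn0 expr0 mul1r.
rewrite -[RHS](det_map_mx (horner_eval 1)) -det_tr; congr (\det _).
apply/matrixP=> i j; rewrite !mxE /= /horner_eval !hornerD !hornerC.
rewrite (inj_eq lift_inj) eq_sym; congr (_ + _).
rewrite (@binom_poly_nat F i j 1) /= /bump !leq0n (@binom_poly_opp_ge F j (1 + i) 1).
congr (_%:R); rewrite (_ : j + (1 + i) = 1 + i + j)%N; last by lia.
by rewrite -[RHS]bin_sub ?leq_addl ?addnK.
Qed.
End Degree.

(** * Roots of the product *)

(** [hole_factor] with the integer [m] replaced by an arbitrary scalar, so that it
    can be evaluated at [m = -1]. *)
Definition hole (F : fieldType) (y : F) (a i : nat) : F :=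
  pochhammer (y / 2%:R + 3%:R * i%:R + 1) (a - 4 * i)./2
  * pochhammer (y / 2%:R + 3%:R * i%:R + 3%:R) (a - 4 * i - 3)./2
  * pochhammer (y / 2%:R + a%:R - i%:R + 1 / 2%:R) (a - 4 * i - 1)./2
  * pochhammer (y / 2%:R + a%:R - i%:R - 1 / 2%:R) (a - 4 * i - 2)./2.

Definition step2_seq s k := [seq (s + 2 * j)%N | j <- iota 0 k].

(** The opposites of the roots of [y |-> hole y a i], which are all negative
    integers: even ones from the first two rising factorials, odd ones from the
    last two. *)
Definition hole_roots a i :=
  step2_seq (2 * (3 * i + 1)) (a - 4 * i)./2
  ++ step2_seq (2 * (3 * i + 3)) (a - 4 * i - 3)./2
  ++ step2_seq (2 * (a - i) + 1) (a - 4 * i - 1)./2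
  ++ step2_seq (2 * (a - i) - 1) (a - 4 * i - 2)./2.

Definition product_roots a := flatten [seq hole_roots a i | i <- index_iota 0 a].

Lemma count_step2_seq n s k :
  count_mem n (step2_seq s k) = [&& s <= n, n < s + 2 * k & odd n == odd s]%N.
Proof.
elim: k => [|k IHk]; first by rewrite /=; lia.
rewrite /step2_seq -[k.+1]addn1 iotaD map_cat count_cat -/(step2_seq s k).
rewrite IHk /= add0n addn0.
by case: eqP; lia.
Qed.

Lemma count_step2_seq_double (b c : bool) k s K :
  count_mem (2 * k + b)%N (step2_seq (2 * s + c) K) = [&& b == c, s <= k & k < s + K]%N.
Proof.
rewrite count_step2_seq.
by case: b; case: c; rewrite ?addn0 ?addn1; congr nat_of_bool; apply/idP/idP; lia.
Qed.

Lemma size_step2_seq s k : size (step2_seq s k) = k.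
Proof. by rewrite size_map size_iota. Qed.

(** The right-hand side uses truncated subtraction, so it is a bound on the
    length of the interval even when the interval is empty. *)
Lemma sum_bool_interval a lo hi (P : nat -> bool) :
  (forall i, (i < a)%N -> P i -> lo <= i < hi)%N ->
  (\sum_(i < a) P i <= hi - lo)%N.
Proof.
move=> sub.
have {sub}: (\sum_(i < a) P i <= minn a hi - lo)%N; last by lia.
elim: a sub => [|a IHa] sub; first by rewrite big_ord0.
have subP : (\sum_(i < a) P i <= minn a hi - lo)%N.
  by apply: IHa => i ltia; apply: sub; lia.
rewrite big_ord_recr /=; have := sub a (ltnSn a).
case: (P a) => [/(_ isT)|_].
  by move: subP; set S := (\sum_(i < a) _)%N => /=; lia.
by move: subP; set S := (\sum_(i < a) _)%N => /=; lia.
Qed.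

Lemma count_product_roots a n :
  count_mem n (product_roots a) = (\sum_(i < a) count_mem n (hole_roots a i))%N.
Proof.
by rewrite count_flatten -map_comp sumnE big_map big_mkord.
Qed.

(** The factors of index [i] that vanish at [-n] come from the first two rising
    factorials only, and for each of these they form an interval of values of
    [i].  The bound is the exponent in [corank_even]. *)
Lemma count_roots_even a n : ~~ odd n ->
  (count_mem n (product_roots a) <= (n + 1) %/ 3 - (n - a))%N.
Proof.
move=> evn; rewrite count_product_roots; set k := n./2.
have Dn : n = (2 * k)%N by lia.
pose P1 i := [&& 3 * i + 1 <= k & k < 3 * i + 1 + (a - 4 * i)./2]%N.
pose P2 i := [&& 3 * i + 3 <= k & k < 3 * i + 3 + (a - 4 * i - 3)./2]%N.
rewrite (eq_bigr (fun i : 'I_a => P1 i + P2 i)%N); last first.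
  move=> i _; have ltia := ltn_ord i.
  rewrite !count_cat Dn -[(2 * k)%N]addn0 -[(2 * (_ + 1))%N]addn0.
  rewrite -[(2 * (_ + 3))%N]addn0.
  rewrite (_ : 2 * (a - i) - 1 = 2 * (a - i - 1) + 1)%N; last by lia.
  rewrite (count_step2_seq_double false false) (count_step2_seq_double false false).
  by rewrite !(count_step2_seq_double false true) !addn0.
rewrite big_split /=.
have le1 : (\sum_(i < a) P1 i <= (k + 2) %/ 3 - (k - a./2))%N.
  by apply: sum_bool_interval => i _; rewrite /P1; lia.
have le2 : (\sum_(i < a) P2 i <= k %/ 3 - (k - (a + 1)./2))%N.
  by apply: sum_bool_interval => i _; rewrite /P2; lia.
by apply: leq_trans (leq_add le1 le2) _; rewrite Dn; lia.
Qed.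

(** As for even roots, with the last two rising factorials; the bound is the
    exponent in [corank_odd]. *)
Lemma count_roots_odd a n : odd n ->
  (count_mem n (product_roots a) <= minn a (n - a) - (n + 1) %/ 3)%N.
Proof.
move=> oddn; rewrite count_product_roots; set k := n./2.
have Dn : n = (2 * k + 1)%N by lia.
pose P3 i := [&& a - i <= k & k < a - i + (a - 4 * i - 1)./2]%N.
pose P4 i := [&& a - i <= k + 1 & k + 1 < a - i + (a - 4 * i - 2)./2]%N.
rewrite (eq_bigr (fun i : 'I_a => P3 i + P4 i)%N); last first.
  move=> i _; have ltia := ltn_ord i.
  rewrite !count_cat Dn -[(2 * (_ + 1))%N]addn0 -[(2 * (_ + 3))%N]addn0.
  rewrite (_ : 2 * (a - i) - 1 = 2 * (a - i - 1) + 1)%N; last by lia.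
  rewrite !(count_step2_seq_double true false) !(count_step2_seq_double true true) !add0n.
  by congr (_ + nat_of_bool _)%N; rewrite /P4; apply/idP/idP; lia.
rewrite big_split /=.
have le1 : (\sum_(i < a) P3 i <= (a + (a - 1)./2 - k + 2) %/ 3 - (a - k))%N.
  by apply: sum_bool_interval => i ltia; rewrite /P3; lia.
have le2 : (\sum_(i < a) P4 i <= (a + (a - 2)./2 - k - 1 + 2) %/ 3 - (a - 1 - k))%N.
  by apply: sum_bool_interval => i ltia; rewrite /P4; lia.
by apply: leq_trans (leq_add le1 le2) _; rewrite Dn; lia.
Qed.

(** Passing from [a] to [a - 4] removes the factor of index 0 and shifts the
    others. *)
Lemma size_product_roots a : size (product_roots a) = (a ^ 2 %/ 4)%N.
Proof.
rewrite size_flatten /shape -map_comp sumnE big_map big_mkord.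
under eq_bigr do rewrite /= !size_cat !size_step2_seq.
pose g b := (b./2 + ((b - 3)./2 + ((b - 1)./2 + (b - 2)./2)))%N.
rewrite (eq_bigr (fun i : 'I_a => g (a - 4 * i)%N)) //.
have sumg N b : (b <= N)%N -> (\sum_(i < N) g (b - 4 * i) = b ^ 2 %/ 4)%N.
  elim: N b => [|N IHN] b leb.
    by rewrite big_ord0; have -> : b = 0%N by lia.
  rewrite big_ord_recl; under eq_bigr do rewrite lift0 mulnS subnDA.
  rewrite IHN; last by lia.
  have [lt4|le4] := ltnP b 4; first by case: b lt4 {leb} => [|[|[|[|]]]].
  rewrite -(subnK le4); set c := (b - 4)%N; rewrite muln0 subn0 addnK.
  rewrite sqrnD (_ : c ^ 2 + 4 ^ 2 + 2 * (c * 4) = (4 + 2 * c) * 4 + c ^ 2)%N; last by lia.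
  by rewrite divnMDl // /g; lia.
exact: sumg.
Qed.

Section Roots.
Variable F : numFieldType.

Lemma pochhammer_step2_seq (y : F) s k :
  pochhammer (y / 2%:R + s%:R / 2%:R) k
  = 2%:R ^- k * \prod_(n <- step2_seq s k) (y + n%:R).
Proof.
rewrite /step2_seq big_map -[X in iota 0 X]subn0 -/(index_iota 0 k) big_mkord.
rewrite -exprVn -[X in _ ^+ X]card_ord -prodr_const -big_split /=.
apply: eq_bigr => j _; rewrite natrD natrM.
by field.
Qed.

Lemma hole_prod_roots (y : F) a i : (i < a)%N ->
  hole y a i = 2%:R ^- size (hole_roots a i) * \prod_(n <- hole_roots a i) (y + n%:R).
Proof.
move=> ltia.
rewrite /hole /hole_roots !size_cat !size_step2_seq !big_cat /= !exprD !invfM.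
rewrite (_ : y / 2%:R + 3%:R * i%:R + 1 =
            y / 2%:R + (2 * (3 * i + 1))%:R / 2%:R); last first.
  by field.
rewrite (_ : y / 2%:R + 3%:R * i%:R + 3%:R =
            y / 2%:R + (2 * (3 * i + 3))%:R / 2%:R); last first.
  by field.
rewrite (_ : y / 2%:R + a%:R - i%:R + 1 / 2%:R =
            y / 2%:R + (2 * (a - i) + 1)%:R / 2%:R); last first.
  by rewrite natrD natrM natrB 1?ltnW //; field.
rewrite (_ : y / 2%:R + a%:R - i%:R - 1 / 2%:R =
            y / 2%:R + (2 * (a - i) - 1)%:R / 2%:R); last first.
  rewrite natrB ?natrM ?natrB; [by field|by lia|by lia].
rewrite !pochhammer_step2_seq; ring.
Qed.

Lemma prod_hole_roots (y : F) a :
  \prod_(i < a) hole y a i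
  = 2%:R ^- (a ^ 2 %/ 4) * \prod_(n <- product_roots a) (y + n%:R).
Proof.
rewrite -size_product_roots /product_roots.
rewrite big_flatten big_map big_mkord.
rewrite size_flatten /shape -map_comp sumnE big_map big_mkord.
rewrite -exprVn -prodrXr -big_split /=.
by apply: eq_bigr => i _; rewrite hole_prod_roots // exprVn.
Qed.
End Roots.

(** * Proportionality and the constant *)

Section Proportional.
Variables (F : numFieldType) (omega : F).
Hypothesis omega_eq : omega ^+ 2 + omega + 1 = 0.

(** The product divides the determinant by the corank bounds, and its degree is
    the upper bound on the degree of the determinant, so the quotient is a
    constant. *)
Lemma det_hole_mx_proportional a : exists kappa, forall y,
  (\det (hole_mx omega a)).[y] = kappa * \prod_(i < a) hole y a i.
Proof.
set D := \det _; pose f n : F := - n%:R.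
pose P := \prod_(x <- map f (product_roots a)) ('X - x%:P).
have [k ->] : exists k, D = k *: P.
  have [->|D0] := eqVneq D 0; first by exists 0; rewrite scale0r.
  have : P %| D.
    apply: dvdp_prod_count => // x.
    have [/mapP[n _ ->]|/count_memPn-> //] := boolP (x \in map f (product_roots a)).
    rewrite count_map (eq_count (a2 := pred1 n)); last first.
      by move=> l /=; rewrite /f eqr_opp eqr_nat.
    rewrite mup_geq // polyCN opprK.
    have [oddn|evn] := boolP (odd n).
      apply: dvdp_trans (corank_odd omega_eq a oddn).
      exact: dvdp_exp2l (count_roots_odd a oddn).
    (* At 0 the counting bound is 0: it is not a root of the product. *)
    have [n0|n_gt0] := posnP n.
      have := count_roots_even a evn; rewrite {2 3}n0 leqn0 => /eqP ->.
      exact: dvd1p.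
    apply: dvdp_trans (corank_even omega_eq a evn n_gt0).
    exact: dvdp_exp2l (count_roots_even a evn).
  case/dvdpP => q Dq; exists q`_0; rewrite Dq -mul_polyC -size1_polyC //.
  have q0 : q != 0 by apply: contraNneq D0 => q0; rewrite Dq q0 mul0r.
  have := size_det_hole_mx omega a; rewrite -/D Dq size_Mmonic ?monic_prod_XsubC //.
  rewrite /P size_prod_XsubC size_map size_product_roots; lia.
exists (k * 2%:R ^+ (a ^ 2 %/ 4)) => y.
rewrite prod_hole_roots hornerZ horner_prod big_map -mulrA mulVKf; last first.
  by rewrite expf_neq0 // pnatr_eq0.
congr (_ * _); apply: eq_bigr => n _.
by rewrite hornerD hornerN hornerX hornerC opprK.
Qed.

End Proportional.

Section Constant.
Variable F : numFieldType.
Local Notation odf := odd_double_fact.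

Lemma odd_double_factS n : odf n.+1 = (odf n * (2 * n + 1))%N.
Proof. by rewrite /odd_double_fact big_nat_recr //=; congr (_ * _)%N; lia. Qed.

Lemma odd_double_fact_add n c :
  odf (n + c) = (odf n * \prod_(i < c) (2 * n + 1 + 2 * i))%N.
Proof.
elim: c => [|c IHc]; first by rewrite big_ord0 addn0 muln1.
by rewrite addnS odd_double_factS IHc big_ord_recr /= mulnA; congr (_ * _)%N; lia.
Qed.

Lemma odd_double_fact_triple k :
  odf (3 * k) = ((\prod_(i < k) ((6 * i + 1) * (6 * i + 5))) * 3 ^ k * odf k)%N.
Proof.
elim: k => [|k IHk]; first by rewrite muln0 big_ord0 expn0 !mul1n.
rewrite mulnS !addSn add0n !odd_double_factS IHk big_ord_recr /= expnS.
by set A := (\prod_(i < k) _)%N; set B := (3 ^ k)%N; ring.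
Qed.

Lemma fact_double k : ((2 * k)`! = 2 ^ k * odf k * k`!)%N.
Proof.
elim: k => [|k IHk]; first by rewrite /odd_double_fact big_geq.
rewrite mulnS !addSn add0n !factS IHk odd_double_factS expnS.
by set A := (2 ^ k)%N; set B := k`!; ring.
Qed.

(** Both sides are [(2k)! / k!]. *)
Lemma prod_upper_half k : (\prod_(i < k) (2 * k - i) = 2 ^ k * odf k)%N.
Proof.
rewrite -ffact_prod; apply/eqP; rewrite -(eqn_pmul2r (fact_gt0 k)) -fact_double.
by rewrite -(@ffact_fact (2 * k) k) ?leq_pmull // mul2n -addnn addnK.
Qed.

Lemma prod_upper_half_pred k :
  (\prod_(i < k.+1) (2 * k + 1 - i) = 2 ^ k * odf k.+1)%N.
Proof.
rewrite -ffact_prod; apply/eqP; rewrite -(eqn_pmul2r (fact_gt0 k)).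
rewrite odd_double_factS mulnA mulnAC -fact_double addn1 [X in _ == X]mulnC -factS.
rewrite -(@ffact_fact (2 * k).+1 k.+1) ?ltnS ?leq_pmull //.
by rewrite subSS mul2n -addnn addnK.
Qed.

Lemma pochhammerSl (x : F) k : pochhammer x k.+1 = x * pochhammer (x + 1) k.
Proof.
rewrite /pochhammer big_ord_recl addr0; congr (_ * _); apply: eq_bigr => i _.
by rewrite lift0 -addn1 natrD; ring.
Qed.

Lemma pochhammerSr (x : F) k : pochhammer x k.+1 = pochhammer x k * (x + k%:R).
Proof. by rewrite /pochhammer big_ord_recr. Qed.

Lemma pochhammer0 (x : F) : pochhammer x 0 = 1.
Proof. by rewrite /pochhammer big_ord0. Qed.

(** The evaluation points [-1] for size [b] and [1] for size [b - 1] are those of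
    [det_hole_mx_opp1].  There the bases of the first two rising factorials differ
    by one and those of the last two agree, so the quotient of the two values
    reduces to a few factors. *)
Lemma hole_ratio_even i v :
  let b := (4 * i + 2 * v + 4)%N in
  hole (-1 : F) b i * (2 * (6 * i + 5 + 2 * v))%N%:R
  = hole (1 : F) b.-1 i * ((6 * i + 1) * (6 * i + 5) * (3 * (i + v + 1)))%N%:R.
Proof.
move=> b; rewrite /hole.
have -> : ((b - 4 * i)./2 = v.+2)%N by lia.
have -> : ((b - 4 * i - 3)./2 = v)%N by lia.
have -> : ((b - 4 * i - 1)./2 = v.+1)%N by lia.
have -> : ((b - 4 * i - 2)./2 = v.+1)%N by lia.
have -> : ((b.-1 - 4 * i)./2 = v.+1)%N by lia.
have -> : ((b.-1 - 4 * i - 3)./2 = v)%N by lia.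
have -> : ((b.-1 - 4 * i - 1)./2 = v.+1)%N by lia.
have -> : ((b.-1 - 4 * i - 2)./2 = v)%N by lia.
have -> : b.-1 = (4 * i + 2 * v + 3)%N by lia.
rewrite {}/b.
set x1 : F := -1 / 2%:R + 3%:R * i%:R + 1.
set x2 : F := -1 / 2%:R + 3%:R * i%:R + 3%:R.
rewrite [pochhammer x1 _]pochhammerSl.
have -> : 1 / 2%:R + 3%:R * i%:R + 1 = x1 + 1 :> F by rewrite /x1; field.
have -> : 1 / 2%:R + 3%:R * i%:R + 3%:R = x2 + 1 :> F by rewrite /x2; field.
set z : F := -1 / 2%:R + _ - _ + _.
have -> : 1 / 2%:R + (4 * i + 2 * v + 3)%N%:R - i%:R + 1 / 2%:R = z :> F.
  by rewrite /z; field.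
set w : F := -1 / 2%:R + _ - _ - _.
have -> : 1 / 2%:R + (4 * i + 2 * v + 3)%N%:R - i%:R - 1 / 2%:R = w :> F.
  by rewrite /w; field.
rewrite [pochhammer w _]pochhammerSr.
have := pochhammerSr x2 v; rewrite pochhammerSl => E2.
have -> : (2 * (6 * i + 5 + 2 * v))%N%:R = 4%:R * (x2 + v%:R) :> F.
  by rewrite /x2; field.
have -> : ((6 * i + 1) * (6 * i + 5) * (3 * (i + v + 1)))%N%:R
   = 4%:R * x1 * x2 * (w + v%:R) :> F.
  by rewrite /x1 /x2 /w; field.
transitivity (4%:R * x1 * pochhammer (x1 + 1) v.+1 * (pochhammer x2 v * (x2 + v%:R))
   * pochhammer z v.+1 * pochhammer w v * (w + v%:R)); first by ring.
by rewrite -E2; ring.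
Qed.

Lemma hole_ratio_odd i v :
  let b := (4 * i + 2 * v + 5)%N in
  hole (-1 : F) b i * (2 * (6 * i + 5 + 2 * v))%N%:R
  = hole (1 : F) b.-1 i * ((6 * i + 1) * (6 * i + 5) * (3 * (i + v + 2)))%N%:R.
Proof.
move=> b; rewrite /hole.
have -> : ((b - 4 * i)./2 = v.+2)%N by lia.
have -> : ((b - 4 * i - 3)./2 = v.+1)%N by lia.
have -> : ((b - 4 * i - 1)./2 = v.+2)%N by lia.
have -> : ((b - 4 * i - 2)./2 = v.+1)%N by lia.
have -> : ((b.-1 - 4 * i)./2 = v.+2)%N by lia.
have -> : ((b.-1 - 4 * i - 3)./2 = v)%N by lia.
have -> : ((b.-1 - 4 * i - 1)./2 = v.+1)%N by lia.
have -> : ((b.-1 - 4 * i - 2)./2 = v.+1)%N by lia.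
have -> : b.-1 = (4 * i + 2 * v + 4)%N by lia.
rewrite {}/b.
set x1 : F := -1 / 2%:R + 3%:R * i%:R + 1.
set x2 : F := -1 / 2%:R + 3%:R * i%:R + 3%:R.
rewrite [pochhammer x2 _]pochhammerSl.
have -> : 1 / 2%:R + 3%:R * i%:R + 1 = x1 + 1 :> F by rewrite /x1; field.
have -> : 1 / 2%:R + 3%:R * i%:R + 3%:R = x2 + 1 :> F by rewrite /x2; field.
set z : F := -1 / 2%:R + _ - _ + _.
have -> : 1 / 2%:R + (4 * i + 2 * v + 4)%N%:R - i%:R + 1 / 2%:R = z :> F.
  by rewrite /z; field.
set w : F := -1 / 2%:R + _ - _ - _.
have -> : 1 / 2%:R + (4 * i + 2 * v + 4)%N%:R - i%:R - 1 / 2%:R = w :> F.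
  by rewrite /w; field.
rewrite [pochhammer z v.+2]pochhammerSr.
have := pochhammerSr x1 v.+2; rewrite pochhammerSl => E1.
have -> : (2 * (6 * i + 5 + 2 * v))%N%:R = 4%:R * (x1 + v.+2%:R) :> F.
  by rewrite -[v.+2]addn2 /x1; field.
have -> : ((6 * i + 1) * (6 * i + 5) * (3 * (i + v + 2)))%N%:R
   = 4%:R * x1 * x2 * (z + v.+1%:R) :> F.
  by rewrite -[v.+1]addn1 /x1 /x2 /z; field.
transitivity (4%:R * x2 * pochhammer (x2 + 1) v * (pochhammer x1 v.+2 * (x1 + v.+2%:R))
   * pochhammer z v.+1 * (z + v.+1%:R) * pochhammer w v.+1); first by ring.
by rewrite -E1; ring.
Qed.

Lemma hole_eq1 (y : F) a i : (a <= 4 * i)%N -> hole y a i = 1.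
Proof.
by rewrite -subn_eq0 => /eqP e0; rewrite /hole e0 !sub0n !pochhammer0 !mulr1.
Qed.

Lemma prod_hole_trunc (y : F) a N : (a <= 4 * N)%N ->
  \prod_(i < a) hole y a i = \prod_(i < N) hole y a i.
Proof.
have stable k : (a <= 4 * k)%N ->
    \prod_(i < k + (a + N - k)) hole y a i = \prod_(i < k) hole y a i.
  move=> lek; rewrite big_split_ord /= [X in _ * X]big1 ?mulr1 // => i _.
  by apply: hole_eq1 => /=; lia.
move=> leN; rewrite -(stable _ leN) -(stable a); last by lia.
rewrite !subnKC //; lia.
Qed.

Lemma odd_double_fact_gt0 n : (0 < odf n)%N.
Proof.
elim: n => [|n IHn]; first by rewrite /odd_double_fact big_geq.
by rewrite odd_double_factS muln_gt0 IHn addn1.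
Qed.

Lemma hole_ratio a i : (2 * i + 2 <= a.+1./2)%N ->
  hole (-1 : F) a.+1 i * (2 * (2 * a.+1./2 + 1 + 2 * i))%N%:R
  = hole (1 : F) a i * ((6 * i + 1) * (6 * i + 5) * (3 * (a./2 - i)))%N%:R.
Proof.
move=> lei; set v := (a.+1./2 - 2 * i - 2)%N.
have -> : (2 * a.+1./2 + 1 + 2 * i = 6 * i + 5 + 2 * v)%N by lia.
have [odda|eva] := boolP (odd a).
  have -> : (a./2 - i = i + v + 1)%N by lia.
  have Da : a.+1 = (4 * i + 2 * v + 4)%N by lia.
  by rewrite -[a]/(a.+1.-1) Da; exact: hole_ratio_even.
have -> : (a./2 - i = i + v + 2)%N by lia.
have Da : a.+1 = (4 * i + 2 * v + 5)%N by lia.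
by rewrite -[a]/(a.+1.-1) Da; exact: hole_ratio_odd.
Qed.

(** The product of the telescoped quotients. Multiplying by an odd double
    factorial completes the denominators to a longer odd double factorial. *)
Lemma prod_hole_ratio a q : (2 * q <= a.+1./2)%N ->
  \prod_(i < q) hole (-1 : F) a.+1 i * (2 ^ q * odf (a.+1./2 + q))%N%:R
  = \prod_(i < q) hole (1 : F) a i *
    (odf a.+1./2 * (\prod_(i < q) ((6 * i + 1) * (6 * i + 5)) * 3 ^ q
                    * \prod_(i < q) (a./2 - i)))%N%:R.
Proof.
move=> le_q; have pow c : (c ^ q = \prod_(i < q) c)%N by rewrite prod_nat_const card_ord.
rewrite odd_double_fact_add mulnCA !(natrM _ (odf _)) !mulrA ![_ * (odf _)%:R]mulrC.
rewrite -!mulrA; congr (_ * _).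
rewrite !pow -mulnA -!big_split /= !natr_prod -!big_split.
apply: eq_bigr => i _; apply: hole_ratio; have := ltn_ord i; lia.
Qed.

Lemma hole_last1 (y : F) i : hole y (4 * i + 1) i = 1.
Proof. by rewrite /hole addKn !pochhammer0 !mulr1. Qed.

Lemma hole_last2 (y : F) i : hole y (4 * i + 2) i = y / 2%:R + 3%:R * i%:R + 1.
Proof. by rewrite /hole addKn pochhammerSl !pochhammer0 !mulr1. Qed.

Lemma hole_last3 (y : F) i : hole y (4 * i + 3) i =
  (y / 2%:R + 3%:R * i%:R + 1) * (y / 2%:R + 3%:R * i%:R + 3%:R + 1 / 2%:R).
Proof.
rewrite /hole addKn !(@pochhammerSl _ 0) !pochhammer0 !mulr1; congr (_ * _).
by field.
Qed.

(** The quotient computed by [prod_hole_ratio] covers all factors but the last,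
    whose few rising factorials depend on [a] modulo 4; the identity
    [odd_double_fact_triple] then collapses everything to one odd double
    factorial. *)
Lemma prod_hole_step a :
  \prod_(i < a.+1) hole (-1 : F) a.+1 i * (odd a).+1%:R
  = \prod_(i < a) hole (1 : F) a i * (odf a.+1./2)%:R.
Proof.
pose q := (a %/ 4)%N.
rewrite (@prod_hole_trunc _ a.+1 q.+1); last by rewrite /q; lia.
rewrite (@prod_hole_trunc _ a q.+1); last by rewrite /q; lia.
have posn (t u : nat) : (2 ^ t * odf u)%N%:R != 0 :> F.
  by rewrite pnatr_eq0 -lt0n muln_gt0 expn_gt0 odd_double_fact_gt0.
have := ltn_mod a 4; have Da := divn_eq a 4; rewrite -/q in Da.
case Er: (a %% 4)%N => [|[|[|[|//]]]] _; rewrite Er in Da; move: Da; rewrite mulnC => Da.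
- have hn : a.+1./2 = (2 * q)%N by lia.
  have := @prod_hole_ratio a q; rewrite hn => /(_ (leqnn _)).
  rewrite [a./2](_ : _ = 2 * q)%N; last by lia.
  rewrite prod_upper_half (_ : 2 * q + q = 3 * q)%N; last by lia.
  move=> E; rewrite !big_ord_recr /=.
  have -> : hole (-1 : F) a.+1 q = 1 by rewrite Da addn0 -addn1 hole_last1.
  have -> : hole (1 : F) a q = 1 by rewrite hole_eq1 // Da addn0.
  have -> : odd a = false by lia.
  rewrite !mulr1; apply: (mulIf (posn q (3 * q)%N)); rewrite E -mulrA -natrM.
  by congr (_ * _%:R); rewrite odd_double_fact_triple; ring.
- have hn : a.+1./2 = (2 * q + 1)%N by lia.
  have := @prod_hole_ratio a q; rewrite hn => /(_ (leq_addr _ _)).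
  rewrite [a./2](_ : _ = 2 * q)%N; last by lia.
  rewrite prod_upper_half (_ : 2 * q + 1 + q = (3 * q).+1)%N; last by lia.
  move=> E; rewrite !big_ord_recr /=.
  have -> : hole (-1 : F) a.+1 q = (6 * q + 1)%N%:R / 2%:R.
    by rewrite Da -addnS hole_last2; field.
  have -> : hole (1 : F) a q = 1 by rewrite Da hole_last1.
  have -> : odd a by lia.
  rewrite mulrA mulfVK ?pnatr_eq0 // mulr1.
  apply: (mulIf (posn q (3 * q)%N)); rewrite -!mulrA -!natrM.
  transitivity (\prod_(i < q) hole (-1 : F) a.+1 i * (2 ^ q * odf (3 * q).+1)%N%:R).
    by congr (_ * _%:R); rewrite odd_double_factS; ring.
  by rewrite E; congr (_ * _%:R); rewrite odd_double_fact_triple; ring.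
- have hn : a.+1./2 = (2 * q + 1)%N by lia.
  have := @prod_hole_ratio a q; rewrite hn => /(_ (leq_addr _ _)).
  rewrite [a./2](_ : _ = 2 * q + 1)%N; last by lia.
  rewrite (_ : 2 * q + 1 + q = (3 * q).+1)%N; last by lia.
  have := prod_upper_half_pred q; rewrite big_ord_recr /=.
  rewrite (_ : 2 * q + 1 - q = q + 1)%N; last by lia.
  set E := (\prod_(i < q) (2 * q + 1 - i))%N => DE eqH; rewrite !big_ord_recr /=.
  have -> : hole (-1 : F) a.+1 q = (3 * (6 * q + 1) * (q + 1))%N%:R / 2%:R.
    by rewrite Da -addnS hole_last3; field.
  have -> : hole (1 : F) a q = (3 * (2 * q + 1))%N%:R / 2%:R.
    by rewrite Da hole_last2; field.
  have -> : odd a = false by lia.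
  rewrite mulr1 !mulrA [RHS]mulrAC; congr (_ / 2%:R).
  apply: (mulIf (posn q (3 * q)%N)); rewrite -!mulrA -!natrM.
  transitivity (\prod_(i < q) hole (-1 : F) a.+1 i
                * (2 ^ q * odf (3 * q).+1)%N%:R * (3 * (q + 1))%N%:R).
    by rewrite -mulrA -natrM; congr (_ * _%:R); rewrite odd_double_factS; ring.
  rewrite eqH -mulrA -natrM; congr (_ * _%:R).
  rewrite odd_double_fact_triple; move: DE; rewrite odd_double_factS => DE.
  set A := (\prod_(i < q) _)%N.
  transitivity (odf (2 * q + 1) * A * 3 ^ q * 3 * (E * (q + 1)))%N; first by ring.
  by rewrite DE; ring.
- have hn : a.+1./2 = (2 * q.+1)%N by lia.
  have := @prod_hole_ratio a q.+1; rewrite hn => /(_ (leqnn _)).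
  rewrite [a./2](_ : _ = 2 * q + 1)%N; last by lia.
  rewrite prod_upper_half_pred (_ : 2 * q.+1 + q.+1 = 3 * q.+1)%N; last by lia.
  move=> E; have -> : odd a by lia.
  apply: (mulIf (posn q (3 * q.+1)%N)); rewrite -!mulrA -!natrM.
  transitivity (\prod_(i < q.+1) hole (-1 : F) a.+1 i * (2 ^ q.+1 * odf (3 * q.+1))%N%:R).
    by congr (_ * _%:R); rewrite expnS /= mulnA.
  by rewrite E; congr (_ * _%:R); rewrite odd_double_fact_triple; ring.
Qed.

Definition scalar_factor a : F := 2%:R ^+ a./2
    / ((\prod_(1 <= i < (a./2).+1) (odf i)%:R)
       * (\prod_(1 <= i < ((a - 1)./2).+1) (odf i)%:R)).

Lemma prod_odd_double_fact_neq0 n : \prod_(1 <= i < n) (odf i)%:R != 0 :> F.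
Proof.
by rewrite prodf_seq_neq0; apply/allP => i _; rewrite pnatr_eq0 -lt0n odd_double_fact_gt0.
Qed.

Lemma scalar_factor_step a :
  scalar_factor a.+1 * (odf a.+1./2)%:R = scalar_factor a * (odd a).+1%:R.
Proof.
have nz n := prod_odd_double_fact_neq0 n; have nzo n : (odf n)%:R != 0 :> F.
  by rewrite pnatr_eq0 -lt0n odd_double_fact_gt0.
rewrite /scalar_factor subSS subn0; have [odda|eva] := boolP (odd a).
  have -> : (a.+1./2 = (a./2).+1)%N by lia.
  have -> : ((a - 1)./2 = a./2)%N by lia.
  rewrite big_nat_recr //= exprS; field; rewrite ?nz ?nzo //.
have -> : (a.+1./2 = a./2)%N by lia.
case: a eva => [_|a eva]; first by rewrite /odd_double_fact !big_geq.
have -> : ((a.+1)./2 = (a./2).+1)%N by lia.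
rewrite subSS subn0 [X in _ / (X * _) * _ = _](_ : _ =
  \prod_(1 <= i < (a./2).+1) (odf i)%:R * (odf (a./2).+1)%:R); last first.
  by rewrite big_nat_recr.
by rewrite mulr1; field; rewrite !nz nzo.
Qed.

Lemma prod_hole1_neq0 a : \prod_(i < a) hole (1 : F) a i != 0.
Proof.
rewrite prod_hole_roots mulf_neq0 ?invr_neq0 ?expf_neq0 ?pnatr_eq0 //.
by rewrite prodf_seq_neq0; apply/allP => n _; rewrite nat1r pnatr_eq0.
Qed.

(** Induction on [a]: the constant of proportionality is found at [X = -1], where
    [det_hole_mx_opp1] brings in the determinant of size [a] at [X = 1]. *)
Lemma det_hole_mxE (omega : F) : omega ^+ 2 + omega + 1 = 0 -> forall a y,
  (\det (hole_mx omega a)).[y] =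
  (1 + omega) ^+ a * scalar_factor a * \prod_(i < a) hole y a i.
Proof.
move=> omega_eq; elim=> [|a IHa] y.
  rewrite det_mx00 -polyC1 hornerC /scalar_factor !big_geq // big_ord0.
  by rewrite !expr0 !mulr1 invr1 !mulr1.
have [kappa Dk] := det_hole_mx_proportional omega_eq a.+1.
rewrite Dk; congr (_ * _).
have step := prod_hole_step a; have prefS := scalar_factor_step a.
have o0 : (odf a.+1./2)%:R != 0 :> F by rewrite pnatr_eq0 -lt0n odd_double_fact_gt0.
have := det_hole_mx_opp1 omega a; rewrite Dk IHa => Ek.
(* [step] says that this nonzero factor is a multiple of the product at -1. *)
apply: (mulIf (mulf_neq0 (prod_hole1_neq0 a) o0)).
rewrite -{1}step [LHS]mulrA Ek exprS.
transitivity ((1 + omega) * (1 + omega) ^+ a * (scalar_factor a * (odd a).+1%:R) *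
  \prod_(i < a) hole 1 a i); first by ring.
by rewrite -prefS; ring.
Qed.
End Constant.

Theorem theorem12 (C : numClosedFieldType) (omega : C)
    (omega_prim : 3.-primitive_root omega) (a m : nat) :
  \det (\matrix_(i < a, j < a)
          (omega * (i == j)%:R + 'C(m + i + j, j)%:R))
  = (1 + omega) ^+ a * 2%:R ^+ a./2
    / ((\prod_(1 <= i < (a./2).+1) (odd_double_fact i)%:R)
       * (\prod_(1 <= i < ((a - 1)./2).+1) (odd_double_fact i)%:R))
    * \prod_(i < a) hole_factor C a m i.
Proof.
have omega_eq : omega ^+ 2 + omega + 1 = 0.
  have w1 : omega - 1 != 0.
    by rewrite subr_eq0 -(expr1 omega) -(prim_order_dvd omega_prim).
  apply: (mulfI w1); rewrite mulr0.
  transitivity (omega ^+ 3 - 1); first by ring.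
  by rewrite (prim_expr_order omega_prim) subrr.
by rewrite -det_hole_mx_nat (det_hole_mxE omega_eq) /scalar_factor mulrA.
Qed.
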